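(* Let $d\ge 1$ and $p\ge 0$ be integers, let $\boldsymbol{\xi}=[\xi_1,\ldots,\xi_d]\in\mathbb{R}^d$ be a random vector with joint probability density function $\rho$, and assume that all moments of $\boldsymbol{\xi}$ of total order at most $2p$ are finite. Let $\mathbf{b}(\boldsymbol{\xi})$ be the vector of all $n=\binom{d+p}{d}$ monomials in $\xi_1,\ldots,\xi_d$ of total degree at most $p$, let $\mathbf{M}=\mathbb{E}[\mathbf{b}(\boldsymbol{\xi})\mathbf{b}(\boldsymbol{\xi})^T]$ be the (positive definite) moment matrix, let $\mathbf{M}=\mathbf{L}\mathbf{L}^T$ be its Cholesky factorization, and let $\boldsymbol{\Psi}(\boldsymbol{\xi})=\mathbf{L}^{-1}\mathbf{b}(\boldsymbol{\xi})$. Then the $n$ components of $\boldsymbol{\Psi}$ form a complete family of basis functions in the space $\mathcal{S}_p$ of all polynomials in $\xi_1,\ldots,\xi_d$ of total degree at most $p$; that is, every function in $\mathcal{S}_p$ can be uniquely expressed as a linear combination of the components of $\boldsymbol{\Psi}$.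
   Context: The components of $\boldsymbol{\xi}$ may be arbitrarily correlated and non-Gaussian. For a multi-index $\boldsymbol{\alpha}=[\alpha_1,\ldots,\alpha_d]\in\mathbb{N}^d$, write $\boldsymbol{\xi}^{\boldsymbol{\alpha}}=\xi_1^{\alpha_1}\cdots\xi_d^{\alpha_d}$ and $|\boldsymbol{\alpha}|=\alpha_1+\cdots+\alpha_d$. The vector $\mathbf{b}(\boldsymbol{\xi})=[b_1(\boldsymbol{\xi}),\ldots,b_n(\boldsymbol{\xi})]^T$ lists the monomials $\boldsymbol{\xi}^{\boldsymbol{\alpha}}$ with $|\boldsymbol{\alpha}|\le p$ in graded lexicographic order. The moment matrix $\mathbf{M}\in\mathbb{R}^{n\times n}$ has entries $m_{ij}=\mathbb{E}[b_i(\boldsymbol{\xi})b_j(\boldsymbol{\xi})]=\int b_i b_j\,\rho\,d\boldsymbol{\xi}$; it is the Gram matrix of the linearly independent monomials and is positive definite. $\mathbf{L}$ is the lower-triangular Cholesky factor (with positive diagonal). A family of functions is called complete in a function space if any function in this space can be uniquely expressed as a linear combination of the functions in the family. *)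

(* Defs.v *)
From HB Require Import structures.
From mathcomp Require Import all_boot all_order all_algebra.
(* The notations of [mpoly] clash with those of MathComp-Analysis. *)
From mathcomp Require Import -(notations) mpoly.
From mathcomp Require Import all_classical all_reals all_analysis.

Set Implicit Arguments.
Unset Strict Implicit.
Unset Printing Implicit Defensive.

Import Order.TTheory GRing.Theory Num.Theory.
Import numFieldNormedType.Exports.

Local Open Scope classical_set_scope.
Local Open Scope ring_scope.

(* Points of R^d are [d.-tuple (measurableTypeR R)], whose measurable sets are
   the Borel sets. The library has no Lebesgue measure on tuples: it is built
   here as the d-fold product of the one-dimensional one, and
   [lebesgue_tuple_box] gives its value on boxes, which characterizes it. *)
Section ProductMeasureCons.
Context {dT : measure_display} {T : measurableType dT} {R : realType} (n : nat).

Definition tuple_cons (z : T * n.-tuple T) : n.+1.-tuple T :=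
  [tuple of z.1 :: z.2].

Lemma measurable_tuple_cons : measurable_fun [set: T * n.-tuple T] tuple_cons.
Proof. exact: measurable_cons. Qed.

Context (m : {sigma_finite_measure set T -> \bar R})
  (mu : {sigma_finite_measure set (n.-tuple T) -> \bar R}).

Definition measure_cons : set (n.+1.-tuple T) -> \bar R :=
  pushforward (m \x mu)%E tuple_cons.

Let measure_cons0 : measure_cons set0 = 0%E.
Proof. by rewrite /measure_cons /pushforward preimage_set0 measure0. Qed.

Let measure_cons_ge0 A : (0 <= measure_cons A)%E.
Proof. by rewrite /measure_cons /pushforward; exact: integral_ge0. Qed.

Let measure_cons_sigma_additive : semi_sigma_additive measure_cons.
Proof.
pose nu : {measure set (T * n.-tuple T)%type -> \bar R} := (m \x mu)%E.
move=> F mF tF mUF; rewrite /measure_cons /pushforward preimage_bigcup.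
have mpre A : measurable A -> measurable (tuple_cons @^-1` A).
  by move=> mA; rewrite -[X in measurable X]setTI; exact: measurable_tuple_cons.
apply: (@measure_semi_sigma_additive _ _ _ nu) => //.
- by move=> k; exact: mpre.
- apply/trivIsetP => i j _ _ ij; rewrite -preimage_setI.
  by move/trivIsetP : tF => /(_ _ _ I I ij) ->; rewrite preimage_set0.
- by rewrite -preimage_bigcup; exact: mpre.
Qed.

HB.instance Definition _ := isMeasure.Build _ _ _ measure_cons
  measure_cons0 measure_cons_ge0 measure_cons_sigma_additive.

Let measure_cons_sigma_finite : sigma_finite setT measure_cons.
Proof.
have /sigma_finiteP[F [TF ndF Ffin]] := sigma_finiteT m.
have /sigma_finiteP[G [TG ndG Gfin]] := sigma_finiteT mu.
pose u (t : n.+1.-tuple T) : T * n.-tuple T := (thead t, [tuple of behead t]).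
have measurable_u : measurable_fun [set: n.+1.-tuple T] u.
  by apply: measurable_fun_pair; [exact: measurable_tnth|exact: measurable_behead].
exists (fun k => u @^-1` (F k `*` G k)).
  rewrite -preimage_bigcup; suff -> : \bigcup_k (F k `*` G k) = setT by [].
  rewrite -subTset => -[x y] _.
  have [k _ Fkx] : (\bigcup_k F k) x by rewrite -TF.
  have [l _ Gly] : (\bigcup_k G k) y by rewrite -TG.
  exists (maxn k l) => //; split.
  - by move: x Fkx; exact/subsetPset/ndF/leq_maxl.
  - by move: y Gly; exact/subsetPset/ndG/leq_maxr.
move=> k; have [mF Fk] := Ffin k; have [mG Gk] := Gfin k; split.
  by rewrite -[_ @^-1` _]setTI; apply: measurable_u => //; exact: measurableX.
rewrite /measure_cons /pushforward -comp_preimage.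
rewrite (_ : u \o tuple_cons = id); last first.
  by apply/funext => -[x t]; congr pair; exact/val_inj.
by rewrite preimage_id product_measure1E// lte_mul_pinfty// ge0_fin_numE.
Qed.

HB.instance Definition _ := Measure_isSigmaFinite.Build _ _ _ measure_cons
  measure_cons_sigma_finite.

End ProductMeasureCons.

Fixpoint lebesgue_tuple (R : realType) (d : nat) :
    {sigma_finite_measure set (d.-tuple (measurableTypeR R)) -> \bar R} :=
  match d with
  | 0 => \d_([tuple] : 0.-tuple (measurableTypeR R))
  | d'.+1 => measure_cons (@lebesgue_measure R) (lebesgue_tuple R d')
  end.

Lemma lebesgue_tuple_box (R : realType) d (A : 'I_d -> set (measurableTypeR R)) :
  (forall i, measurable (A i)) ->
  lebesgue_tuple R d [set t | forall i, A i (tnth t i)] =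
  (\prod_(i < d) lebesgue_measure (A i))%E.
Proof.
elim: d A => [|d IH] A mA /=.
  by rewrite big_ord0 diracE mem_set // => -[].
rewrite big_ord_recl -IH // /measure_cons /pushforward.
rewrite -product_measure1E //; last first.
  have -> : [set t | forall i, A (lift ord0 i) (tnth t i)] =
            \bigcap_(i in [set: 'I_d])
              ((fun t : d.-tuple (measurableTypeR R) => tnth t i) @^-1` A (lift ord0 i)).
    by apply/seteqP; split=> t /= At i; [move=> _; exact: At|exact: (At i I)].
  apply: fin_bigcap_measurable; first exact: finite_finset.
  by move=> i _; rewrite -[_ @^-1` _]setTI; exact: measurable_tnth.
congr (_ _); apply/seteqP; split=> -[x t] /= At.
  split=> [|i]; first exact: (At ord0).
  by have := At (lift ord0 i); rewrite tnthS.
move=> i; case: (unliftP ord0 i) => [j ->|->]; last exact: At.1.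
by rewrite tnthS; exact: At.2.
Qed.

Section MultiIndices.
Variables d p : nat.

(* Degree first, then lexicographic with the larger exponent of xi_1 first: for
   d = p = 2 the enumeration is 1, xi_1, xi_2, xi_1^2, xi_1 xi_2, xi_2^2. On
   multi-indices of equal degree [mnmc_le] is the lexicographic order. *)
Definition grlex (a b : multinom d) : bool :=
  (mdeg a < mdeg b)%N ||
  (mdeg a == mdeg b) && mnmc_le b a.

Definition multi_indices_seq : seq (multinom d) :=
  sort grlex [seq bmnm a | a <- enum {: bmultinom d p.+1}].

Lemma size_multi_indices : size multi_indices_seq == 'C(d + p, d).
Proof.
rewrite size_sort size_map -cardE -card_partial_ord_partitions.
pose f (a : bmultinom d p.+1) : d.-tuple 'I_p.+1 := [tuple inord (a i) | i < d].
have fE a i : tnth (f a) i = a i :> nat.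
  rewrite tnth_mktuple inordK // (leq_ltn_trans _ (bmdeg a)) //.
  by rewrite mdegE (bigD1 i) //= leq_addr.
have f_inj : injective f.
  move=> a b fab; apply/val_inj/mnmP => i.
  by rewrite -(fE a i) fab (fE b i).
rewrite -(card_imset _ f_inj); apply/eqP/eq_card => t; rewrite inE.
apply/imsetP/idP => [[a _ ->]|tp].
  rewrite big_tuple (eq_bigr (fun i => a i)) => [|i _]; last exact: fE.
  by rewrite -mdegE -ltnS bmdeg.
pose a : multinom d := Multinom [tuple val (tnth t i) | i < d].
have aE i : a i = tnth t i by rewrite /= multinomE tnth_mktuple.
have ap : (mdeg a < p.+1)%N.
  rewrite ltnS mdegE (eq_bigr (fun i => tnth t i : nat)) => [|i _]; last exact: aE.
  by rewrite -(big_tuple _ _ _ xpredT (fun x : 'I_p.+1 => x : nat)).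
exists (BMultinom ap) => //; apply: eq_from_tnth => i; apply/val_inj.
by rewrite /= fE aE.
Qed.

Definition multi_indices : 'C(d + p, d).-tuple (multinom d) :=
  Tuple size_multi_indices.

End MultiIndices.

Section PolynomialBasis.
Variables (R : realType) (d p : nat).
Local Notation Rd := (d.-tuple (measurableTypeR R)).
Local Notation n := 'C(d + p, d).

Definition monomial (a : multinom d) (x : Rd) : R := \prod_(i < d) tnth x i ^+ a i.

Definition monomials (x : Rd) : 'cV[R]_n :=
  \col_i monomial (tnth (multi_indices d p) i) x.

Definition poly_space : set (Rd -> R) :=
  [set f | exists2 q : mpoly d R, (msize q <= p.+1)%N &
                                  f = fun x => meval (tnth x) q].

Definition complete_in (S : set (Rd -> R)) m (F : 'I_m -> Rd -> R) : Prop :=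
  forall f, S f -> exists! c : 'I_m -> R, f = fun x => \sum_i c i * F i x.

Context {dO : measure_display} {Omega : measurableType dO}
  (P : probability Omega R) (xi : {RV P >-> Rd}).

Definition has_density (rho : Rd -> R) : Prop :=
  [/\ measurable_fun setT rho,
      forall x, 0 <= rho x &
      forall A, measurable A ->
        distribution P xi A = (\int[lebesgue_tuple R d]_(x in A) (rho x)%:E)%E].

Definition finite_moments (k : nat) : Prop :=
  forall a : multinom d, (mdeg a <= k)%N ->
    P.-integrable setT (fun w => (monomial a (xi w))%:E).

Definition moment_mx : 'M[R]_n :=
  \matrix_(i, j) fine ('E_P[(fun w => monomials (xi w) i 0 * monomials (xi w) j 0)%R])%E.

End PolynomialBasis.

Section Cholesky.
Context {R : realType} {n : nat}.

(* [is_trig_mx] is lower triangularity. *)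
Definition is_cholesky (M L : 'M[R]_n) : Prop :=
  [/\ is_trig_mx L, forall i, 0 < L i i & M = L *m L^T].

(* The default value 0 is only taken when M is not symmetric positive definite;
   otherwise the Cholesky factor exists and is unique. *)
Definition cholesky (M : 'M[R]_n) : 'M[R]_n := xget 0 [set L | is_cholesky M L].

End Cholesky.

Definition Psi {R : realType} {d p : nat} (L : 'M[R]_('C(d + p, d)))
    (i : 'I_('C(d + p, d))) (x : d.-tuple (measurableTypeR R)) : R :=
  (invmx L *m monomials p x) i 0.

(* Main.v *)
(* A nonzero polynomial vanishes only on a Lebesgue-null set: fix the first
   coordinate x, note that for all but finitely many x the polynomial in the
   remaining coordinates is still nonzero, and use Fubini. Since xi has a
   density, Q(xi) = 0 then has probability 0 for every nonzero Q. For Q = v b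
   this gives E[Q(xi)^2] = v M v^T > 0, so M is positive definite, its Cholesky
   factor L exists and is invertible; it also gives the linear independence of
   the monomials, and L^-1 b is then an invertible change of basis. *)
Require Import Defs.
From HB Require Import structures.
From mathcomp Require Import all_boot all_order all_algebra.
From mathcomp Require Import -(notations) mpoly.
From mathcomp Require Import all_classical all_reals all_analysis.
From mathcomp Require Import measurable_realfun ring.
Import Order.TTheory GRing.Theory Num.Theory.
Local Open Scope classical_set_scope.
Local Open Scope ring_scope.

(** * Zero sets of nonzero polynomials are Lebesgue-null *)

Lemma finite_set_poly_roots {R : idomainType} {r : {poly R}} :
  r != 0 -> finite_set [set x | root r x].
Proof.
have [m] := ubnP (size r); elim: m r => // m IH r rm r0.
have [[a ra]|nr] := pselect (exists a, root r a); last first.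
  by rewrite (_ : mkset _ = set0)//;
     apply/seteqP; split=> x //= rx;
     apply: nr; exists x.
have /factor_theorem[q rE] := ra.
have q0 : q != 0 by apply: contraNneq r0 => q0; rewrite rE q0 mul0r.
have fq : finite_set [set x | root q x].
  apply: IH => //; move: rm.
  by rewrite rE size_Mmonic ?monicXsubC// size_XsubC addn2.
apply: (@sub_finite_set _ _ ([set a] `|` [set x | root q x])); last first.
  by rewrite finite_setU; split.
by move=> x /=; rewrite rE rootM root_XsubC => /orP[|/eqP]; [right|left].
Qed.

Section ZeroSet.
Variable R : realType.

Lemma measurable_meval {d} (q : mpoly d R) :
  measurable_fun setT
    (fun x : d.-tuple (measurableTypeR R) => meval (tnth x) q : measurableTypeR R).
Proof.
under eq_fun do rewrite mevalE.
apply: measurable_sum => m; apply: measurable_funM => //.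
apply: measurable_prod => i _; apply: measurable_funX.
exact: measurable_tnth.
Qed.

Lemma measurable_zeros {d} (q : mpoly d R) :
  measurable [set x : d.-tuple (measurableTypeR R) | meval (tnth x) q = 0].
Proof.
have := measurable_meval q measurableT [set 0] (measurable_set1 _).
by rewrite setTI.
Qed.

Definition mtail {d} (a : multinom d.+1) : multinom d :=
  Multinom [tuple a (lift ord0 i) | i < d].

Lemma mtailE d (a : multinom d.+1) i : mtail a i = a (lift ord0 i).
Proof. by rewrite /mtail multinomE tnth_mktuple. Qed.

Lemma mtail_inj {d} (a b : multinom d.+1) :
  a ord0 = b ord0 -> mtail a = mtail b -> a = b.
Proof.
move=> ab0 abt; apply/mnmP => i; case: (unliftP ord0 i) => [j ->|->]//.
by rewrite -!mtailE abt.
Qed.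

(* The polynomial [q(x, _)] in the last [d] variables. *)
Definition msection {d} (q : mpoly d.+1 R) (x : R) : mpoly d R :=
  \sum_(a <- msupp q) (mcoeff a q * x ^+ a ord0) *: mpolyX R (mtail a).

Lemma meval_msection {d} (q : mpoly d.+1 R) x (t : d.-tuple R) :
  meval (tnth t) (msection q x) = meval (tnth [tuple of x :: t]) q.
Proof.
rewrite /msection raddf_sum mevalE; apply: eq_bigr => a _ /=.
rewrite mevalZ mevalX big_ord_recl tnth0 mulrA; congr (_ * _).
by apply: eq_bigr => i _; rewrite tnthS mtailE.
Qed.

(** For a fixed [a] in the support of [q], the coefficient of [mtail a] in the section at [x] is a
    univariate polynomial [r] evaluated at [x]. It is not the zero polynomial, and every [x] with
    zero section is one of its roots. *)
Lemma finite_msection_eq0 {d} (q : mpoly d.+1 R) :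
  q != 0 -> finite_set [set x | msection q x = 0].
Proof.
move=> q0; have [a aq] : exists a, a \in msupp q.
  case E : (msupp q) => [|a s]; last by exists a; rewrite mem_head.
  by move: q0; rewrite -msupp_eq0 E.
pose r : {poly R} :=
  \sum_(b <- msupp q | mtail b == mtail a) mcoeff b q *: 'X^(b ord0).
have r0 : r != 0.
  (* Among the multi-indices with tail [mtail a], only [a] has first exponent [a ord0], so nothing
     cancels and this coefficient is that of [a] in [q]. *)
  have : r`_(a ord0) != 0.
    rewrite /r coef_sum big_mkcond (bigD1_seq a) ?msupp_uniq//= eqxx big1 ?addr0.
      by rewrite coefZ coefXn eqxx mulr1 -mcoeff_msupp.
    move=> b nba; case: ifPn => // /eqP ba; rewrite coefZ coefXn.
    case: eqP => [ab|]; rewrite ?mulr0//.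
    by case/eqP: nba; exact: mtail_inj.
  by apply: contraNneq => ->; rewrite coef0.
apply: sub_finite_set (finite_set_poly_roots r0) => x /= qx.
have : mcoeff (mtail a) (msection q x) = r.[x].
  rewrite /msection /r raddf_sum horner_sum [RHS]big_mkcond.
  apply: eq_bigr => b _ /=.
  by rewrite mcoeffZ mcoeffX; case: eqP => _;
    rewrite ?mulr0// hornerZ hornerXn mulr1.
by rewrite qx mcoeff0 /root => <-.
Qed.

Lemma lebesgue_tuple_zeros {d} (q : mpoly d R) : q != 0 ->
  lebesgue_tuple R d [set x | meval (tnth x) q = 0] = 0.
Proof.
elim: d q => [|d IH] q q0.
  (* In dimension 0 the only multi-index is 0, so [q] is constant and its value at the empty tuple
     is its only coefficient. *)
  rewrite /= diracE memNset//= => qt; case/negP: q0; apply/eqP.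
  have s0 (m : multinom 0) : m = mnm0 by apply/mnmP => -[].
  apply/mpolyP => m; rewrite (s0 m) mcoeff0 -[RHS]qt mevalE.
  rewrite {1}[q]mpolyE raddf_sum; apply: eq_bigr => a _ /=.
  by rewrite mcoeffZ mcoeffX (s0 a) eqxx big_ord0.
rewrite /= /measure_cons /pushforward /product_measure1 /=.
set Z := (X in xsection X).
have mZ : measurable Z.
  rewrite -[Z]setTI; exact: measurable_tuple_cons (measurable_zeros q).
have ZE x : xsection Z x = [set t | meval (tnth t) (msection q x) = 0].
  apply/seteqP; split => t; rewrite /xsection /= inE /Z /= meval_msection//.
pose N := [set x | msection q x = 0] : set (measurableTypeR R).
have fN : finite_set N by exact: finite_msection_eq0.
(* The integrand is the measure of the slice at [x]. The induction hypothesis makes it 0 outside the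
   finite, hence null, set [N]. *)
rewrite (@ge0_negligible_integral _ _ _ _ _ N)//.
- apply: integral0_eq => x [_ /= Nx]; rewrite ZE.
  by apply: IH; apply/eqP.
- rewrite -[N]image_id -bigcup_imset1.
  by apply: fin_bigcup_measurable => // i _; exact: measurable_set1.
- exact: measurable_fun_xsection.
- exact/countable_lebesgue_measure0/finite_set_countable.
Qed.

End ZeroSet.

(** * Positive definite matrices and existence of the Cholesky factor *)

Definition posdef {R : realType} {n} (M : 'M[R]_n) : Prop :=
  M^T = M /\ forall v : 'rV_n, v != 0 -> 0 < (v *m M *m v^T) 0 0.

(** Induction that peels off the first row and column: with corner [a] and column [b] below it, the
    factor has corner [sqrt a], column [b / sqrt a], and in the lower right block the factor of the
    Schur complement. *)
Lemma cholesky_exists {R : realType} n (M : 'M[R]_n) :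
  posdef M -> exists L, is_cholesky M L.
Proof.
elim: n M => [|n IH]; last rewrite -[n.+1]/(1 + n)%N; move=> M [sM pM].
  exists 0; split;
    [by apply/is_trig_mxP => -[]|by case|by apply/matrixP => -[]].
pose a := M 0 0.
pose b : 'cV[R]_n := dlsubmx M.
pose C : 'M[R]_n := drsubmx M.
have ME : M = block_mx a%:M b^T b C.
  rewrite -[LHS](submxK M); congr block_mx.
    by rewrite [ulsubmx _]mx11_scalar !mxE /a !lshift0.
  by rewrite /b trmx_dlsub sM.
have sC : C^T = C by rewrite /C trmx_drsub sM.
have a0 : 0 < a.
  (* Testing on the first unit vector isolates the corner entry. *)
  have := pM (row_mx 1%:M 0 : 'rV[R]_(1 + n)).
  rewrite ME mul_row_block !mul1mx !mul0mx !addr0 tr_row_mx mul_row_col.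
  rewrite trmx1 mulmx1 trmx0 mulmx0 addr0 mxE mulr1n; apply.
  apply/eqP => /(congr1 (fun A : 'M[R]_(1, 1 + n) => A 0 (lshift n 0))).
  by rewrite row_mxEl !mxE => /eqP; rewrite oner_eq0.
(* The Schur complement of the corner entry [a] is again positive definite:
   its value at [v] is that of [M] at [(- (v b) / a, v)]. *)
have [|L' [tL' dL' SE]] := IH (C - a^-1 *: (b *m b^T)).
  split.
    by rewrite linearB linearZ /= trmx_mul trmxK sC.
  move=> v v0.
  have [be vb] : exists be, v *m b = be%:M by eexists; exact: mx11_scalar.
  have bv : b^T *m v^T = be%:M by rewrite -trmx_mul vb tr_scalar_mx.
  have := pM (row_mx (- (a^-1 * be))%:M v : 'rV[R]_(1 + n)).
  rewrite ME mul_row_block tr_row_mx mul_row_col => H.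
  apply: lt_le_trans (H _) _.
    apply: contra_neq v0 => /(congr1 (rsubmx : 'M[R]_(1, 1 + n) -> _)).
    by rewrite row_mxKr linear0.
  rewrite vb mulmxBr -scalemxAr mulmxA vb !mulmxDl mulNmx -scalemxAl.
  rewrite -[X in _ *: X]mulmxA bv.
  rewrite -!mulmxA bv tr_scalar_mx -!scalar_mxM scale_scalar_mx !mxE /=.
  (* The two sides are in fact equal: both are [v C v^T - be^2 / a]. *)
  rewrite !mulr1n le_eqVlt; apply/orP; left; apply/eqP.
  by field; rewrite gt_eqF.
have sa0 : Num.sqrt a != 0 by rewrite sqrtr_eq0 -ltNge.
exists (block_mx (Num.sqrt a)%:M 0 ((Num.sqrt a)^-1 *: b) L'); split.
- rewrite (is_trig_block_mx _ _ _ _ (erefl 1%N)) eqxx tL' andbT /=.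
  exact: scalar_mx_is_trig.
- move=> i; case: (split_ordP i) => j ->.
    by rewrite block_mxEul ord1 mxE mulr1n sqrtr_gt0.
  by rewrite block_mxEdr.
- rewrite ME tr_block_mx mulmx_block trmx0 !mul0mx !mulmx0 !addr0 -SE.
  rewrite tr_scalar_mx -scalar_mxM -expr2 sqr_sqrtr ?ltW//.
  rewrite linearZ /= mul_scalar_mx mul_mx_scalar !scalerA mulfV// !scale1r.
  rewrite -scalemxAl -scalemxAr scalerA -invfM -expr2 sqr_sqrtr ?ltW//.
  by rewrite addrC subrK.
Qed.

(** * Coefficient rows and polynomials of degree at most [p] *)

Lemma mem_multi_indices d p (a : multinom d) :
  (a \in multi_indices d p) = (mdeg a <= p)%N.
Proof.
rewrite /multi_indices memtE /= /multi_indices_seq mem_sort; apply/mapP/idP.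
  by move=> [b _ ->]; rewrite -ltnS bmdeg.
by rewrite -ltnS => ap; exists (BMultinom ap); rewrite ?mem_enum.
Qed.

Lemma tnth_multi_indices_inj d p : injective (tnth (multi_indices d p)).
Proof.
apply/tuple_uniqP; rewrite /= /multi_indices_seq sort_uniq.
by rewrite map_inj_uniq ?enum_uniq//; exact: val_inj.
Qed.

Section MonomialCombination.
Variables (R : realType) (d p : nat).
Local Notation n := 'C(d + p, d).
Local Notation idx := (tnth (multi_indices d p)).
Implicit Types (v : 'rV[R]_n) (q : mpoly d R).

(** The formal polynomial behind the function [v b]: its coefficients can be read off, which gives
    back [v]. *)
Definition mpoly_of_row v : mpoly d R := \sum_i v 0 i *: mpolyX R (idx i).

Lemma meval_mpoly_of_row v x :
  meval (tnth x) (mpoly_of_row v) = (v *m monomials p x) 0 0.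
Proof.
rewrite raddf_sum mxE; apply: eq_bigr => i _ /=.
by rewrite mevalZ mevalX mxE.
Qed.

Lemma mcoeff_mpoly_of_row v i : mcoeff (idx i) (mpoly_of_row v) = v 0 i.
Proof.
rewrite raddf_sum (bigD1 i)//= big1 ?addr0 => [|j ji].
  by rewrite mcoeffZ mcoeffX eqxx mulr1.
by rewrite mcoeffZ mcoeffX (inj_eq (@tnth_multi_indices_inj d p)) (negbTE ji)
     mulr0.
Qed.

Lemma mpoly_of_row_eq0 v : mpoly_of_row v = 0 -> v = 0.
Proof. by move=> v0; apply/rowP => i; rewrite -mcoeff_mpoly_of_row v0 mcoeff0 mxE. Qed.

(** [msize] exceeds the degree of a nonzero polynomial by one, so the bound says degree at most [p];
    the row collects the coefficients along the list of multi-indices. *)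
Lemma mpoly_of_rowP q :
  (msize q <= p.+1)%N <-> exists v, q = mpoly_of_row v.
Proof.
split=> [qp|[v ->]].
  exists (\row_i mcoeff (idx i) q); apply/mpolyP => m.
  have [mp|mp] := boolP (m \in multi_indices d p).
    by have /tnthP[i ->] := mp; rewrite mcoeff_mpoly_of_row mxE.
  (* A multi-index outside the list has degree above [p], so its coefficient vanishes on both
     sides. *)
  rewrite raddf_sum big1 /= => [|i _].
    apply: memN_msupp_eq0; apply: msize_mdeg_ge; apply: leq_trans qp _.
    by rewrite ltnNge -mem_multi_indices.
  rewrite mcoeffZ mcoeffX; case: eqP => [im|]; rewrite ?mulr0//.
  by rewrite -im mem_tnth in mp.
apply: leq_trans (msize_sum _ _ _) _; apply/bigmax_leqP => i _.
apply: leq_trans (msizeZ_le _ _) _; rewrite msizeX ltnS.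
by rewrite -mem_multi_indices mem_tnth.
Qed.

Lemma poly_spaceP (f : d.-tuple (measurableTypeR R) -> R) :
  poly_space p f <-> exists v, f = fun x => (v *m monomials p x) 0 0.
Proof.
split=> [[q /mpoly_of_rowP[v ->] ->]|[v ->]].
  by exists v; apply/funext => x; rewrite meval_mpoly_of_row.
exists (mpoly_of_row v); first by apply/mpoly_of_rowP; exists v.
by apply/funext => x; rewrite meval_mpoly_of_row.
Qed.

End MonomialCombination.
Arguments mpoly_of_row {R d p} v.

(** * Moments, positive definiteness and linear independence *)

Lemma monomialD (R : realType) d (a b : multinom d)
    (x : d.-tuple (measurableTypeR R)) :
  monomial (mnm_add a b) x = monomial a x * monomial b x.
Proof. by rewrite /monomial -big_split; apply: eq_bigr => i _; rewrite mnmDE exprD. Qed.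

(** The [fine] on the right matches the entries of [moment_mx]; integrability makes these integrals
    finite, so it loses nothing. *)
Lemma integral_lincomb {dO} {T : measurableType dO} {R : realType}
    (mu : {measure set T -> \bar R}) (I : finType) (c : I -> R) (f : I -> T -> R) :
  (forall i, mu.-integrable setT (EFin \o f i)) ->
  (\int[mu]_x (\sum_i c i * f i x)%:E =
   (\sum_i c i * fine (\int[mu]_x (f i x)%:E)%E)%:E)%E.
Proof.
move=> intf; under eq_integral do rewrite -sumEFin.
rewrite integral_sum => // [|i]; last first.
  under eq_fun do rewrite EFinM.
  by apply: integrableZl => //; exact: intf.
rewrite -sumEFin; apply: eq_bigr => i _.
under eq_integral do rewrite EFinM.
rewrite integralZl//; last exact: intf.
by rewrite EFinM fineK//; apply: integrable_fin_num => //; exact: intf.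
Qed.

Section Moments.
Context {R : realType} {d : nat} (p : nat) {dO : measure_display}
  {Omega : measurableType dO} {P : probability Omega R}
  {xi : {RV P >-> d.-tuple (measurableTypeR R)}}.
Local Notation n := 'C(d + p, d).
Implicit Types v : 'rV[R]_n.

(** The law of [xi] is absolutely continuous, so it gives no mass to the Lebesgue-null zero set. *)
Lemma density_zeros_negligible {rho} {q : mpoly d R} :
  has_density xi rho -> q != 0 ->
  P.-negligible [set w | meval (tnth (xi w)) q = 0].
Proof.
move=> [mrho rho0 Prho] q0.
have mZ := measurable_zeros R q.
apply/negligibleP.
  by have := measurable_funPT xi measurableT _ mZ; rewrite setTI.
rewrite -[LHS]/(distribution P xi [set x | meval (tnth x) q = 0]) Prho//.
apply: null_set_integral => //; last exact: lebesgue_tuple_zeros.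
exact/measurable_EFinP/measurable_funTS.
Qed.

Lemma setT_not_negligible : ~ P.-negligible setT.
Proof.
move=> /(negligibleP P measurableT) P0.
by have /eqP := etrans (esym (probability_setT P)) P0; rewrite onee_eq0.
Qed.

(** A product of two basis monomials is a monomial of degree at most [2 * p], hence integrable, so
    the expectation passes through the double sum expanding the square. *)
Lemma moment_quadratic_form v : finite_moments xi (2 * p) ->
  ((v *m moment_mx p xi *m v^T) 0 0)%:E =
  (\int[P]_w ((v *m monomials p (xi w)) 0 0 ^+ 2)%:E)%E.
Proof.
move=> hmom.
pose f (ij : 'I_n * 'I_n) w := monomials p (xi w) ij.1 0 * monomials p (xi w) ij.2 0.
have intf ij : P.-integrable setT (EFin \o f ij).
  pose a := mnm_add (tnth (multi_indices d p) ij.1)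
                    (tnth (multi_indices d p) ij.2).
  rewrite (_ : _ \o _ = fun w => (monomial a (xi w))%:E).
    apply: hmom; rewrite mdegD mul2n -addnn.
    by rewrite leq_add// -mem_multi_indices mem_tnth.
  by apply/funext => w; rewrite monomialD /f /= !mxE.
transitivity (\int[P]_w (\sum_ij (v 0 ij.1 * v 0 ij.2) * f ij w)%:E)%E.
  rewrite integral_lincomb//.
  rewrite -(pair_big xpredT xpredT (fun i j =>
    v 0 i * v 0 j * fine (\int[P]_w (f (i, j) w)%:E)%E)) /=.
  rewrite mxE exchange_big; congr EFin; apply: eq_bigr => j _ /=.
  rewrite !mxE mulr_suml; apply: eq_bigr => i _.
  by rewrite mxE unlock mulrAC.
apply: eq_integral => w _; congr EFin.
rewrite -(pair_big xpredT xpredT (fun i j => v 0 i * v 0 j * f (i, j) w)) /=.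
rewrite mxE expr2 mulr_suml; apply: eq_bigr => i _.
by rewrite mulr_sumr; apply: eq_bigr => j _; rewrite mulrACA.
Qed.

Lemma moment_mx_posdef {rho} : has_density xi rho -> finite_moments xi (2 * p) ->
  posdef (moment_mx p xi).
Proof.
move=> hrho hmom; split.
  apply/matrixP => i j; rewrite !mxE; congr (fine (expectation P _)).
  by apply/funext => w; rewrite mulrC.
move=> v v0; rewrite -lte_fin moment_quadratic_form//.
rewrite lt_neqAle integral_ge0 ?andbT; last by move=> w _; rewrite lee_fin sqr_ge0.
have q0 : mpoly_of_row v != 0 by apply: contra_neq v0; exact: mpoly_of_row_eq0.
have mQ : measurable_fun setT (fun w => ((v *m monomials p (xi w)) 0 0)).
  under eq_fun do rewrite -meval_mpoly_of_row.
  exact: measurableT_comp (measurable_meval _ _) _.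
apply/eqP => /esym;
(* The square is written as an absolute value to fit the criterion that a vanishing integral of
   [|f|] forces [f = 0] almost everywhere. *)
under eq_integral do rewrite -[(_ ^+ 2)]ger0_norm ?sqr_ge0// -abse_EFin.
move/(ae_eq_integral_abs P measurableT).
move=> /(_ _) [|N [mN PN subN]].
  by apply/measurable_EFinP; exact: measurable_funX.
apply: setT_not_negligible.
apply: negligibleS (negligibleU _ (density_zeros_negligible hrho q0)); last first.
  exact/(negligibleP P mN).
(* If the integral were 0, the polynomial would vanish at [xi w] for every [w] outside [N]; two
   negligible sets would then cover the whole space. *)
move=> w _; have [Nw|Nw] := pselect (N w); [by left|right].
rewrite /= meval_mpoly_of_row; apply: contrapT => Qw; apply: Nw; apply: subN => /=.
by move=> /(_ I) [] /eqP; rewrite sqrf_eq0 => /eqP.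
Qed.

(** If [v] were nonzero, the event that [xi] is a zero of the polynomial would be negligible, yet it
    is the whole space. *)
Lemma monomials_free {rho v} : has_density xi rho ->
  (forall x : d.-tuple (measurableTypeR R), v *m monomials p x = 0) -> v = 0.
Proof.
move=> hrho v0; apply: mpoly_of_row_eq0; apply/eqP; apply: contraT => q0.
have [] := setT_not_negligible.
apply: negligibleS (density_zeros_negligible hrho q0) => w _ /=.
by rewrite meval_mpoly_of_row v0 mxE.
Qed.

End Moments.

(** * Change of basis by the Cholesky factor *)

Lemma cholesky_posdef {R : realType} {n} (M : 'M[R]_n) :
  posdef M -> is_cholesky M (cholesky M).
Proof. by move=> /cholesky_exists[L LM]; apply: (xgetPex 0); exists L. Qed.

Lemma is_cholesky_unitmx {R : realType} {n} (M L : 'M[R]_n) :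
  is_cholesky M L -> L \in unitmx.
Proof.
move=> [tL dL _]; rewrite unitmxE det_trig// unitfE.
by apply/prodf_neq0 => i _; rewrite gt_eqF.
Qed.

Theorem lemma1 (R : realType) (d p : nat) (hd : (1 <= d)%N)
    (dO : measure_display) (Omega : measurableType dO) (P : probability Omega R)
    (xi : {RV P >-> d.-tuple (measurableTypeR R)})
    (rho : d.-tuple (measurableTypeR R) -> R)
    (hrho : has_density xi rho)
    (hmom : finite_moments xi (2 * p)%N) :
  let L := cholesky (moment_mx p xi) in
  (forall i, poly_space p (Psi L i)) /\
  complete_in (poly_space p) (Psi L).
Proof.
move=> L.
have uL : L \in unitmx.
  exact/is_cholesky_unitmx/cholesky_posdef/(moment_mx_posdef _ hrho).
have PsiE (c : 'I_('C(d + p, d)) -> R) x : \sum_i c i * Psi L i x =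
    ((\row_i c i) *m invmx L *m monomials p x) 0 0.
  by rewrite -mulmxA mxE; apply: eq_bigr => i _; rewrite mxE.
split=> [i|f /poly_spaceP[v ->]].
  apply/poly_spaceP; exists (row i (invmx L)); apply/funext => x.
  by rewrite -row_mul mxE.
(* The coefficients come from [v b = (v L) (L^-1 b)]. *)
exists ((v *m L) 0); split.
  apply/funext => x; rewrite PsiE.
  by rewrite (_ : \row_i _ = v *m L) ?mulmxK//; apply/rowP => i; rewrite mxE.
move=> c vc; apply/funext => i.
suff -> : v *m L = \row_i c i by rewrite mxE.
(* Uniqueness becomes [v - c L^-1 = 0], a row whose combination of the monomials vanishes at every
   point. *)
apply/esym/(canRL (mulmxKV uL))/esym/eqP; rewrite -subr_eq0; apply/eqP.
apply: (monomials_free p hrho) => x; rewrite mulmxBl [LHS]mx11_scalar.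
apply/matrixP => j k; rewrite !ord1 mxE mxE.
have := congr1 (fun f => f x) vc; rewrite /= PsiE => ->.
by rewrite !mxE subrr.
Qed.
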